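(* Let $p>5$ be a prime. Then $$\sum_{k=1}^{p-1}\frac{L_k}{k^2}\equiv 0\pmod p,$$ where the Lucas numbers $L_0,L_1,L_2,\ldots$ are defined by $L_0=2$, $L_1=1$ and $L_{n+1}=L_n+L_{n-1}$ for $n=1,2,3,\ldots$.
   Context: The congruence is between rational numbers whose denominators are prime to $p$: $x\equiv y\pmod{p}$ means $x-y\in p\mathbb{Z}_{(p)}$, where $\mathbb{Z}_{(p)}$ is the ring of rational numbers with denominator prime to $p$. *)

(* Defs.v *)
From mathcomp Require Import all_boot all_order all_algebra.

Set Implicit Arguments.
Unset Strict Implicit.
Unset Printing Implicit Defensive.

Import Order.TTheory GRing.Theory Num.Theory.

Local Open Scope ring_scope.

Fixpoint lucas (n : nat) : nat :=
  match n with
  | 0 => 2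
  | n1.+1 => match n1 with
             | 0 => 1
             | n2.+1 => (lucas n1 + lucas n2)%N
             end
  end.

(* The ring Z_(p), as a predicate on rat: [denq x] is the positive denominator
   of [x] in lowest terms. *)
Definition Zloc (p : nat) : {pred rat} :=
  [pred x : rat | coprime p `|denq x|%N].

(* x - y \in p Z_(p) *)
Definition rat_eqmod (p : nat) (x y : rat) : Prop :=
  exists2 z : rat, z \in Zloc p & x - y = p%:R * z.

(* Main.v *)
(** Work in a field [K] of characteristic [p] containing a root [x] of
    [x^2 = x + 1], with conjugate [1 - x], and put
    [Li_s (y) = \sum_(1 <= k < p) y^k / k^s].  By Binet's formula the sum is
    [A + B] with [A = Li_2 (x)], [B = Li_2 (1 - x)].  Three functional equations
    hold: reversing the sum ([k -> p - k]) relates [y] and [y^-1]; splitting by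
    parity relates [y], [-y] and [y^2]; and a polynomial with zero derivative
    and degree below [2p] that vanishes at 0 and 1 is zero, which gives
    [Li_1 (1 - y) = Li_1 (y)] and
    [Li_1 (y)^2 + 2 y^p Li_2 (y) + 2 (1 - y^p) Li_2 (1 - y) = 0].
    Let [a = x^p], so that [a^2 = a + 1] by Frobenius, and [g = Li_1 (x)].  The
    last equation at [x] reads [g^2 + 2 a A + 2 (1 - a) B = 0]; at [x^2], where
    [1 - x^2 = - x = (1 - x)^-1], the other ones turn it into
    [g^2 + 4 (1 + a) A + 6 B = 0].  The difference is [2 (2 + a) (A + B) = 0],
    and [(2 + a) (3 - a) = 5], so [A + B = 0]. *)

Require Import Defs.
From mathcomp Require Import all_boot all_order all_algebra all_field.
From mathcomp Require Import ring.

Import Order.TTheory GRing.Theory Num.Theory.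

Local Open Scope ring_scope.

(* The term of index 0 vanishes for [s > 0], since [0^-1 = 0]. *)
Definition polylog (F : fieldType) (p s : nat) : {poly F} :=
  \poly_(k < p) (k%:R ^- s).

Lemma polylog_horner (F : fieldType) (p s : nat) (x : F) :
  (0 < p)%N -> (0 < s)%N ->
  (polylog F p s).[x] = \sum_(1 <= k < p) k%:R ^- s * x ^+ k.
Proof.
move=> p0 s0; rewrite /polylog horner_poly.
rewrite -(big_mkord xpredT (fun k => k%:R ^- s * x ^+ k)) big_ltn //.
by rewrite expr0n eqn0Ngt s0 invr0 mul0r add0r.
Qed.

Lemma sum_even_odd (V : zmodType) (n : nat) (f : nat -> V) :
  \sum_(0 <= m < n + n) f m =
  \sum_(0 <= k < n) f k.*2 + \sum_(0 <= k < n) f k.*2.+1.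
Proof.
elim: n => [|n IHn]; first by rewrite !big_geq ?addr0.
rewrite addSn addnS !big_nat_recr //= IHn addnn -!addrA; congr (_ + _).
by rewrite addrCA.
Qed.

(** * Functional equations of finite polylogarithms in characteristic [p] *)

Section CharP.

Variables (F : fieldType) (p : nat).
Hypothesis chF : p \in [pchar F].

Let p_prime : prime p. Proof. exact: pcharf_prime chF. Qed.
Let p_gt0 : (0 < p)%N. Proof. exact: prime_gt0. Qed.

Lemma natr_pchar_neq0 n : (0 < n < p)%N -> n%:R != 0 :> F.
Proof.
move=> /andP[n0 np]; rewrite -(dvdn_pcharf chF).
by apply/negP => /(dvdn_leq n0); rewrite leqNgt np.
Qed.

(** Adding the values at [x] and [-x] of the sum over two periods [m < 2p] keeps twice the even
    terms, and the term of index [2k] is [2^-s (x^2)^k / k^s]. *)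
Lemma polylog_distribution s (x : F) : (0 < s)%N -> (2 < p)%N ->
  2 ^+ s * ((1 + x ^+ p) * (polylog F p s).[x] +
            (1 - x ^+ p) * (polylog F p s).[- x]) =
  2 * (polylog F p s).[x ^+ 2].
Proof.
move=> s0 p2.
have two0 : 2 != 0 :> F by exact: natr_pchar_neq0.
pose T (y : F) := \sum_(0 <= m < p + p) m%:R ^- s * y ^+ m.
(* The coefficients have period [p], so the second half is [y ^+ p] times the first. *)
have TE y : T y = (1 + y ^+ p) * (polylog F p s).[y].
  rewrite /T (big_cat_nat (n := p)) ?leq_addr //= horner_poly mulrDl mul1r.
  rewrite !big_mkord; congr (_ + _).
  rewrite -{1}[p]add0n big_addn addnK big_mkord big_distrr /=.
  apply: eq_bigr => k _.
  by rewrite natrD (pcharf0 chF) addr0 exprD; ring.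
have odd_p : odd p by case: (even_prime p_prime) p2 => [->|].
have -> : 1 - x ^+ p = 1 + (- x) ^+ p.
  by rewrite exprNn -signr_odd odd_p expr1 mulN1r.
have T_even_odd y : T y = \sum_(0 <= k < p) k.*2%:R ^- s * y ^+ k.*2 +
                          \sum_(0 <= k < p) k.*2.+1%:R ^- s * y ^+ k.*2.+1.
  exact: sum_even_odd.
rewrite -!TE !T_even_odd addrACA -2!big_split /= -[RHS]addr0 mulrDr.
congr (_ + _); last first.
  rewrite big1 ?mulr0 // => k _.
  by rewrite exprNn -signr_odd /= odd_double /= expr1; ring.
rewrite horner_poly !big_distrr /= big_mkord; apply: eq_bigr => k _.
rewrite exprNn -signr_odd /= odd_double expr0 mul1r -mul2n natrM exprMn exprM.
by rewrite invfM !mulrDr !mulrA mulfV ?expf_neq0 //; ring.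
Qed.

Lemma polylog_inversion s (x : F) : (0 < s)%N -> x != 0 ->
  x ^+ p * (polylog F p s).[x^-1] = (-1) ^+ s * (polylog F p s).[x].
Proof.
move=> s0 x0; rewrite !polylog_horner // [in RHS]big_nat_rev !big_distrr /=.
apply: eq_big_nat => k /andP[k1 kp].
rewrite add1n subSS natrB ?(ltnW kp) // (pcharf0 chF) sub0r.
rewrite -{1}(subnK (ltnW kp)) exprD [(- k%:R) ^+ s]exprNn exprVn invfM.
rewrite invr_sign !mulrA -[in RHS]expr2 sqrr_sign mul1r mulrAC -!mulrA.
by rewrite mulVKf ?expf_neq0 // mulrC.
Qed.

(** The Euler operator lowers the order by one. The target order must be positive: at order 0 the
    constant term would be 1. *)
Lemma deriv_polylogS s : 'X * (polylog F p s.+2)^`() = polylog F p s.+1.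
Proof.
apply/polyP => k; rewrite coefXM coef_deriv !coef_poly.
case: k => [|k] /=; first by rewrite p_gt0 exprS mul0r invr0.
case: ifP => kp; last by rewrite mul0rn.
have k0 : k.+1%:R != 0 :> F by apply: natr_pchar_neq0.
by rewrite -[LHS]mulr_natl [_ ^+ s.+2]exprS invfM mulVKf.
Qed.

Lemma deriv_polylog1 : ('X - 1) * (polylog F p 1)^`() = 'X^(p.-1) - 1.
Proof.
rewrite subrX1; congr (_ * _).
have -> : (polylog F p 1)^`() = \poly_(k < p.-1) 1.
  apply/polyP => k; rewrite coef_deriv !coef_poly -ltn_predRL.
  case: ifP => kp; last by rewrite mul0rn.
  have k0 : k.+1%:R != 0 :> F by apply: natr_pchar_neq0; rewrite -ltn_predRL.
  by rewrite -[LHS]mulr_natl expr1 mulfV.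
by rewrite poly_def; apply: eq_bigr => k _; rewrite scale1r.
Qed.

(** A zero derivative leaves only exponents divisible by [p], that is 0 and [p] below [2p]; the
    values at 0 and 1 then kill both coefficients. *)
Lemma deriv0_eq0 (P : {poly F}) : (size P <= p + p)%N -> P^`() = 0 ->
  P.[0] = 0 -> P.[1] = 0 -> P = 0.
Proof.
move=> szP dP P0 P1.
have P00 : P`_0 = 0 by rewrite -horner_coef0.
have coefP0 k : (k != p)%N -> P`_k = 0.
  case: (ltnP k (p + p)) => [kp | kp]; last first.
    by move=> _; rewrite nth_default // (leq_trans szP).
  case: k kp => // k kp knep.
  have: P^`()`_k = 0 by rewrite dP coef0.
  rewrite coef_deriv -mulr_natr => /eqP; rewrite mulf_eq0 => /orP[/eqP//|].
  rewrite -(dvdn_pcharf chF) => /dvdnP[[|[|j]] ej] //.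
    by rewrite ej mul1n eqxx in knep.
  by move: kp; rewrite ej !mulSn addnA ltnNge leq_addr.
have PE : P = P`_p *: 'X^p.
  apply/polyP => k; rewrite coefZ coefXn.
  by case: eqVneq => [-> | /coefP0 ->]; rewrite ?mulr1 ?mulr0.
by move: P1; rewrite PE hornerZ hornerXn expr1n mulr1 => ->; rewrite scale0r.
Qed.

Lemma polylog_horner0 s : (0 < s)%N -> (polylog F p s).[0] = 0.
Proof.
move=> s0; rewrite polylog_horner // big_nat big1 // => k /andP[k0 _].
by rewrite expr0n eqn0Ngt k0 mulr0.
Qed.

Lemma polylog1_horner1 : (2 < p)%N -> (polylog F p 1).[1] = 0.
Proof.
move=> p2; have := @polylog_inversion 1 1 isT (oner_neq0 F).
rewrite invr1 expr1n expr1 mul1r mulN1r => /eqP.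
rewrite -subr_eq0 opprK -mulr2n -mulr_natl mulf_eq0.
by rewrite (negPf (natr_pchar_neq0 _ _)) // => /eqP.
Qed.

Lemma polylog2_horner1 : (3 < p)%N -> (polylog F p 2).[1] = 0.
Proof.
move=> p3; have := @polylog_distribution 2 1 isT (ltnW p3).
rewrite !expr1n subrr mul0r addr0 => /eqP; rewrite -subr_eq0 => /eqP E.
(* At 1 the distribution relation says [8 c = 2 c]. *)
have : (2 * 3) * (polylog F p 2).[1] = 0 by rewrite -E; ring.
move=> /eqP; rewrite !mulf_eq0 !(negPf (natr_pchar_neq0 _ _)) ?(ltnW p3) //.
by move=> /eqP.
Qed.

Let size_1subX : size (1 - 'X : {poly F}) = 2.
Proof. by rewrite -size_polyN opprB -polyC1 size_XsubC. Qed.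

Lemma polylog1_reflection : (2 < p)%N ->
  polylog F p 1 \Po (1 - 'X) = polylog F p 1.
Proof.
move=> p2; apply/eqP; rewrite -subr_eq0; apply/eqP.
have chP : p \in [pchar {poly F}] by rewrite pchar_poly.
apply: deriv0_eq0.
- apply: leq_trans (size_polyD _ _) _; rewrite geq_max size_polyN.
  rewrite (size_comp_poly2 _ size_1subX).
  by rewrite (leq_trans (size_poly _ _)) ?leq_addr.
- have X0 : 'X != 0 :> {poly F} by rewrite polyX_eq0.
  have X1 : 'X - 1 != 0 :> {poly F} by rewrite -polyC1 polyXsubC_eq0.
  (* Multiplying by [X (X - 1)] clears the denominators of both derivatives; what remains is
     [1 - (1 - X)^p - X^p], zero by Frobenius. *)
  apply: (mulfI X0); apply: (mulfI X1); rewrite !mulr0.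
  rewrite derivB deriv_comp derivB derivC derivX.
  have := congr1 (comp_poly (1 - 'X)) deriv_polylog1.
  have := deriv_polylog1.
  rewrite comp_polyM !comp_polyB comp_polyC comp_polyX comp_Xn_poly.
  set V := _^`() \Po _; set W := _^`().
  move=> EW EV.
  transitivity (('X - 1) * ((1 - 'X - 1) * V) - 'X * (('X - 1) * W)).
    by rewrite sub0r; ring.
  rewrite EW EV.
  transitivity (1 - (1 - 'X) * (1 - 'X) ^+ p.-1 - 'X * 'X^(p.-1) : {poly F}).
    by ring.
  rewrite -!exprS prednK // exprDn_pchar ?pnatE // expr1n.
  by rewrite exprNn_pchar ?pnatE //; ring.
- rewrite hornerD hornerN horner_comp !hornerE subr0.
  by rewrite polylog1_horner1 // polylog_horner0 // subr0.
- rewrite hornerD hornerN horner_comp !hornerE subrr.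
  by rewrite polylog1_horner1 // polylog_horner0 // subr0.
Qed.

(* Granville's identity: up to sign, [polylog F p 1] is the reduction mod [p] of
   the Fermat quotient [(X^p - (X - 1)^p - 1) / p]. *)
Lemma polylog2_reflection (y : F) : (3 < p)%N ->
  (polylog F p 1).[y] ^+ 2 + 2 * (y ^+ p * (polylog F p 2).[y]) +
    2 * ((1 - y ^+ p) * (polylog F p 2).[1 - y]) = 0.
Proof.
move=> p3; have p2 := ltnW p3.
have szp s : (size (polylog F p s) <= p)%N by apply: size_poly.
have sz2 (Q : {poly F}) : (size Q <= p + p)%N -> (size (2 * Q)%R <= p + p)%N.
  by move=> szQ; rewrite mulr_natl mulr2n (leq_trans (size_polyD _ _)) // maxnn.
have szM (P Q : {poly F}) :
    (size P <= p.+1)%N -> (size Q <= p)%N -> (size (P * Q)%R <= p + p)%N.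
  move=> szP szQ; apply: leq_trans (size_polyMleq _ _) _.
  by rewrite -subn1 leq_subLR add1n -addSn leq_add.
pose P : {poly F} := polylog F p 1 ^+ 2 + 2 * ('X^p * polylog F p 2) +
  2 * ((1 - 'X^p) * (polylog F p 2 \Po (1 - 'X))).
have PE z : P.[z] = (polylog F p 1).[z] ^+ 2 +
    2 * (z ^+ p * (polylog F p 2).[z]) +
    2 * ((1 - z ^+ p) * (polylog F p 2).[1 - z]).
  rewrite /P ![2 * _]mulr_natl !(hornerD, hornerMn, hornerM, horner_exp).
  by rewrite !(hornerN, horner_comp, hornerD, hornerXn, hornerX, hornerC).
rewrite -PE; suff -> : P = 0 by rewrite horner0.
apply: deriv0_eq0.
- rewrite (leq_trans (size_polyD _ _)) // geq_max sz2 ?andbT; last first.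
    apply: szM; last by rewrite (size_comp_poly2 _ size_1subX).
    rewrite (leq_trans (size_polyD _ _)) // size_polyN size_polyXn size_poly1.
    by rewrite geq_max ltnS leqnn.
  rewrite (leq_trans (size_polyD _ _)) // geq_max sz2 ?andbT; last first.
    by apply: szM; rewrite ?size_polyXn.
  by apply: szM => //; rewrite leqW.
- have X1 : 'X - 1 != 0 :> {poly F} by rewrite -polyC1 polyXsubC_eq0.
  apply: (mulfI X1); rewrite mulr0.
  have dXp : 'X^p^`() = 0 :> {poly F}.
    by rewrite derivXn -mulr_natr -polyC_natr (pcharf0 chF) mulr0.
  have E1 := deriv_polylog1.
  have E2 := deriv_polylogS 0.
  have := congr1 (comp_poly (1 - 'X)) E2.
  rewrite comp_polyM comp_polyX polylog1_reflection // => E3.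
  have d2 (Q : {poly F}) : (2 * Q)^`() = 2 * Q^`().
    by rewrite !mulr_natl derivMn.
  rewrite /P expr2 !derivD !d2 !derivM derivB dXp derivC deriv_comp derivB.
  rewrite derivC derivX.
  have XpE : 'X^p = 'X * 'X^(p.-1) :> {poly F} by rewrite -exprS prednK.
  rewrite XpE.
  move: E1 E2 E3; set W := (polylog F p 1)^`(); set V := (polylog F p 2)^`().
  set U := V \Po _ => E1 E2 E3.
  (* Since [X^p] has derivative zero, only the polylogarithms are differentiated; after substitution
     each summand is a multiple of [polylog F p 1], and the multiples cancel. *)
  transitivity (2 * polylog F p 1 * (('X - 1) * W) +
    2 * ('X - 1) * 'X^(p.-1) * ('X * V) +
    2 * (1 - 'X * 'X^(p.-1)) * ((1 - 'X) * U)); first by ring.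
  by rewrite E1 E2 E3; ring.
- rewrite PE expr0n eqn0Ngt p_gt0 !polylog_horner0 // subr0.
  by rewrite polylog2_horner1 //; ring.
- rewrite PE subrr !polylog_horner0 // polylog1_horner1 //.
  by rewrite polylog2_horner1 //; ring.
Qed.

(** * Evaluation at the golden ratio *)

Lemma polylog2_golden (x : F) : (5 < p)%N -> x ^+ 2 = x + 1 ->
  (polylog F p 2).[x] + (polylog F p 2).[1 - x] = 0.
Proof.
move=> p5 x2.
have p3 : (3 < p)%N by apply: ltn_trans p5.
have p2 : (2 < p)%N by apply: ltn_trans p5.
have nz2 : 2 != 0 :> F by apply: natr_pchar_neq0.
have nz5 : 5 != 0 :> F by apply: natr_pchar_neq0.
have x1 : (1 - x) * (- x) = 1.
  by transitivity (x ^+ 2 - x); [ring | rewrite x2; ring].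
have nzb : 1 - x != 0.
  by apply/eqP => b0; move: x1; rewrite b0 mul0r => /esym/eqP; rewrite oner_eq0.
have invb : (1 - x)^-1 = - x by apply: (mulfI nzb); rewrite mulfV.
pose a := x ^+ p.
have frob y z : (y + z) ^+ p = y ^+ p + z ^+ p :> F.
  by rewrite exprDn_pchar // pnatE.
have a2 : a ^+ 2 = a + 1 by rewrite /a exprAC x2 frob expr1n.
have bp : (1 - x) ^+ p = 1 - a.
  by rewrite frob expr1n exprNn_pchar // pnatE.
have nza : a ^+ 2 != 0.
  apply: expf_neq0; apply/eqP => a0; move: a2; rewrite a0 expr0n add0r /=.
  by move/esym/eqP; rewrite oner_eq0.
have refl1 y : (polylog F p 1).[1 - y] = (polylog F p 1).[y].
  by rewrite -{2}(polylog1_reflection p2) horner_comp !hornerE.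
(* Inversion at [1 - x] reaches [-x], which is both its inverse and [1 - x ^+ 2]. *)
have invA := @polylog_inversion 2 (1 - x) isT nzb.
have invG := @polylog_inversion 1 (1 - x) isT nzb.
have dist := @polylog_distribution 2 x isT p2.
have E1 := polylog2_reflection x p3;
  have E2 := polylog2_reflection (x ^+ 2) p3; have E3 := refl1 (x ^+ 2).
have ox2 : 1 - x ^+ 2 = - x by rewrite x2; ring.
rewrite ox2 in E2 E3; rewrite exprAC -/a in E2.
rewrite invb bp refl1 in invG; rewrite invb bp sqrrN expr1n mul1r in invA.
rewrite -/a in dist E1; rewrite -E3 in E2.
move: E1 E2 invA invG dist; rewrite expr1.
set A := (polylog F p 2).[x]; set B := (polylog F p 2).[1 - x].
set C := (polylog F p 2).[x ^+ 2]; set A' := (polylog F p 2).[- x].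
set g := (polylog F p 1).[x]; set d := (polylog F p 1).[- x].
move=> E1 E2 invA invG dist.
have a1 : (1 - a) * (- a) = 1.
  by transitivity (a ^+ 2 - a); [ring | rewrite a2; ring].
have A'E : A' = - a * B by rewrite -invA mulrA [- a * _]mulrC a1 mul1r.
have dE : d = a * g.
  by rewrite -[LHS]mul1r -a1 mulrAC invG; ring.
have CE : C = 2 * ((1 + a) * A + B).
  by apply: (mulfI nz2); rewrite -dist invA; ring.
(* This is the reflection identity at [x ^+ 2], divided by [a ^+ 2]. *)
have E2' : g ^+ 2 + 4 * (1 + a) * A + 6 * B = 0.
  apply: (mulfI nza); rewrite mulr0 -E2 dE A'E CE.
  have -> : 1 - a ^+ 2 = - a by rewrite a2; ring.
  by ring.
have: 2 * 5 * (A + B) = 0.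
  (* The factor [3 - a] turns the coefficient [2 (2 + a)] of [A + B] into [2 * 5], modulo
     [a ^+ 2 = a + 1]. *)
  transitivity ((3 - a) * ((g ^+ 2 + 4 * (1 + a) * A + 6 * B) -
     (g ^+ 2 + 2 * (a * A) + 2 * ((1 - a) * B))) +
     2 * (a ^+ 2 - (a + 1)) * (A + B)); first by ring.
  by rewrite E2' E1 a2 !subrr; ring.
by move/eqP; rewrite !mulf_eq0 (negPf nz2) (negPf nz5) => /eqP.
Qed.

End CharP.

(** * Binet's formula and a field containing the golden ratio *)

Lemma lucas_binet (R : comNzRingType) (x : R) (n : nat) : x ^+ 2 = x + 1 ->
  (lucas n)%:R = x ^+ n + (1 - x) ^+ n.
Proof.
move=> x2; suff: (lucas n)%:R = x ^+ n + (1 - x) ^+ n /\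
  (lucas n.+1)%:R = x ^+ n.+1 + (1 - x) ^+ n.+1 by case.
elim: n => [|n [IH0 IH1]]; first by rewrite /= !expr0 !expr1; split; ring.
split=> //; rewrite [lucas _]/(lucas n.+1 + lucas n)%N natrD IH0 IH1.
transitivity (x ^+ n * (x ^+ 2) + (1 - x) ^+ n * ((1 - x) ^+ 2)).
  have -> : (1 - x) ^+ 2 = 1 - x + 1 by rewrite sqrrB x2; ring.
  by rewrite x2 !exprS; ring.
by rewrite !exprS; ring.
Qed.

(** A splitting field of [X^2 - X - 1] over ['F_p] serves whether or not 5 is a square mod [p]. *)
Lemma golden_field_exists (p : nat) : prime p ->
  exists (K : fieldType) (x : K), (p \in [pchar K]) /\ x ^+ 2 = x + 1.
Proof.
move=> p_prime; pose P : {poly 'F_p} := 'X^2 - ('X + 1).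
have szP : size P = 3.
  by rewrite size_polyDl size_polyXn // size_polyN -polyC1 size_XaddC.
have nzP : P != 0 by rewrite -size_poly_gt0 szP.
have [L [rs Prs _]] := FinSplittingFieldFor nzP.
have : size (\prod_(z <- rs) ('X - z%:P)) = 3.
  by rewrite -(eqp_size Prs) size_map_poly.
case: rs Prs => [|x rs] Prs; first by rewrite big_nil size_poly1.
move=> _; exists L, x; split; first by rewrite pchar_lalg pchar_Fp.
have : root (map_poly (in_alg L) P) x.
  by rewrite (eqp_root Prs) root_prod_XsubC mem_head.
rewrite /P rmorphB rmorphD rmorph1 /= map_polyXn map_polyX => /rootP.
by rewrite !hornerE => /eqP; rewrite subr_eq0 => /eqP.
Qed.

(** * Return to the rationals *)

Lemma divq_Zloc (p : nat) (m d : int) : d != 0 -> coprime p `|d| ->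
  m%:~R / d%:~R \in Zloc p.
Proof.
move=> d0 pd; rewrite inE /=; apply: coprime_dvdr pd.
set x := _ / _; have : numq x * d = m * denq x.
  apply/eqP; rewrite -(eqr_int rat) !rmorphM /=.
  have xd : x * d%:~R = m%:~R by rewrite divfK ?intr_eq0.
  by rewrite numqE mulrAC xd.
move/(congr1 absz); rewrite !abszM => E.
(* By Gauss's lemma the reduced denominator divides [d]. *)
have: (`|denq x| %| `|numq x| * `|d|)%N by rewrite E dvdn_mull.
by rewrite Gauss_dvdr // coprime_sym coprime_num_den.
Qed.

Lemma coprime_fact (p m : nat) : prime p -> (m < p)%N -> coprime p m`!.
Proof.
move=> p_prime; elim: m => [|m IHm] mp; first by rewrite coprimen1.
rewrite factS coprimeMr IHm ?(ltnW mp) // andbT prime_coprime //.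
by apply/negP => /(dvdn_leq (ltn0Sn m)); rewrite leqNgt mp.
Qed.

Theorem theorem1p2 (p : nat) (p_prime : prime p) (p_gt5 : (5 < p)%N) :
  rat_eqmod p (\sum_(1 <= k < p) (lucas k)%:R / (k%:R ^+ 2 : rat)) 0.
Proof.
have [K [x [chK x2]]] := golden_field_exists p p_prime.
(* Multiplying by [f ^ 2] clears all denominators and gives a natural number [N], which can be read
   both in [K] and in [rat]. *)
pose f := (p.-1)`!; pose q k := (f %/ k)%N.
pose N := (\sum_(1 <= k < p) lucas k * q k ^ 2)%N.
have qE k : (1 <= k < p)%N -> (q k * k)%N = f.
  move=> /andP[k1 kp]; rewrite divnK // dvdn_fact // k1 /=.
  by rewrite -ltnS prednK // prime_gt0.
have sumE (L : fieldType) : (forall k, (1 <= k < p)%N -> k%:R != 0 :> L) ->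
    N%:R = f%:R ^+ 2 * \sum_(1 <= k < p) (lucas k)%:R / k%:R ^+ 2 :> L.
  move=> nz; rewrite natr_sum big_distrr /=; apply: eq_big_nat => k kp.
  have k0 := nz k kp.
  by rewrite -(qE k kp) !(natrM, natrX); field.
have /dvdnP[n Nn] : (p %| N)%N.
  rewrite (dvdn_pcharf chK) sumE; last by move=> k; apply: natr_pchar_neq0.
  have <- : (polylog K p 2).[x] + (polylog K p 2).[1 - x] =
      \sum_(1 <= k < p) (lucas k)%:R / k%:R ^+ 2.
    rewrite !polylog_horner ?prime_gt0 // -big_split /=.
    by apply: eq_bigr => k _; rewrite (lucas_binet _ _ _ x2); ring.
  by rewrite polylog2_golden // mulr0.
have pf : coprime p f.
  by apply: coprime_fact; rewrite // prednK // prime_gt0.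
(* From [N = n * p] and [N = f ^ 2] times the sum, the quotient of the sum by [p] is [n / f ^ 2]. *)
exists (n%:Z%:~R / (f ^ 2)%N%:Z%:~R).
  apply: divq_Zloc; first by rewrite eqz_nat -lt0n expn_gt0 fact_gt0.
  by rewrite absz_nat coprimeXr.
have f0 : f%:R != 0 :> rat by rewrite pnatr_eq0 -lt0n fact_gt0.
rewrite subr0; apply: (mulfI (expf_neq0 2 f0)); rewrite -sumE; last first.
  by move=> k /andP[k1 _]; rewrite pnatr_eq0 -lt0n.
by rewrite Nn natrM -!pmulrn natrX; field.
Qed.
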